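(* Let $k\in\mathbb{N}$, let $\mathcal{D}:\mathbb{R}_{>0}\times\mathbb{N}\to\mathbb{R}_{>0}$ be an arbitrary function, let $\eta>0$, and let $N=N(\eta,\mathcal{D})>0$ be the number given by the regularity theorem stated in the context. Let $Z$ be a finite abelian group, let $f:Z\to\mathbb{C}$ be a 1-bounded function, and let $m\in[1,N]$, $Y$, $\phi:Z\to Y$, $F:Y\to\mathbb{C}$, the decomposition $f=f_s+f_e+f_r$ with $f_s=F\circ\phi$, the set $S\subset\widehat{Z_k(Y)}$, and the decomposition $f_s=\sum_{\chi\in S}g_\chi+g_e$ with $g_\chi=F_\chi\circ\phi$, be the data provided for $f$ by that regularity theorem. Suppose in addition that $\|f\|_{U^{k+1}}\ge\delta>0$. Then $$\max_{\chi\in S}|\langle f,g_\chi\rangle|\ \ge\ \frac{\delta^{2^{k+1}}}{4|S|}=\Omega_\delta(1).$$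
   Context: Finite groups. $Z$ is a finite abelian group; $\langle f,g\rangle=\mathbb{E}_{x\in Z}f(x)\overline{g(x)}$, $\|f\|_p=(\mathbb{E}_x|f(x)|^p)^{1/p}$ for finite $p$, $\|f\|_\infty=\max|f|$; 1-bounded means $|f|\le1$. $\|f\|_{U^k}=\big(\mathbb{E}_{x,t_1,\dots,t_k}\prod_{v\in\{0,1\}^k}\mathcal{C}^{|v|}f(x+v_1t_1+\cdots+v_kt_k)\big)^{1/2^k}$, with $\mathcal{C}$ complex conjugation and $|v|=\sum v_i$. For $f,g:Z\to\mathbb{C}$, $\langle f,g\rangle_{U^k}=\mathbb{E}_{x,t_1,\dots,t_k}\prod_{v\in\{0,1\}^k}\mathcal{C}^{|v|}f_v(x+v_1t_1+\cdots+v_kt_k)$ with $f_v=f$ if $v_k=0$ and $f_v=g$ if $v_k=1$. $\Omega_\delta(1)$ denotes a quantity bounded below by a positive constant depending only on $\delta$ (with $k$ and the fixed choices below regarded as fixed). Regularity theorem. Let $k\in\mathbb{N}$ and let $\mathcal{D}:\mathbb{R}_{>0}\times\mathbb{N}\to\mathbb{R}_{>0}$ be an arbitrary function. For every $\eta>0$ there exists $N=N(\eta,\mathcal{D})>0$ such that for every finite abelian group $Z$ and every 1-bounded $f:Z\to\mathbb{C}$, for some $m\in[1,N]$ there exist a $k$-step cfr nilspace $Y$ of complexity at most $m$, a $\mathcal{D}(\eta,m)$-balanced morphism $\phi:Z\to Y$, and a 1-bounded $m$-Lipschitz function $F:Y\to\mathbb{C}$, such that $f=f_s+f_e+f_r$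 with $f_s=F\circ\phi$, $\|f_e\|_1\le\eta$, $\|f_r\|_\infty\le1$, and $\max(\|f_r\|_{U^{k+1}},|\langle f_r,f_s\rangle|,|\langle f_r,f_e\rangle|)\le\mathcal{D}(\eta,m)$. Moreover there is a set $S\subset\widehat{Z_k(Y)}$ with $|S|\le Q(\eta,m)$ such that, letting $g_\chi=F_\chi\circ\phi$ for $\chi\in S$, we have $f_s=\sum_{\chi\in S}g_\chi+g_e$, where $\|g_e\|_\infty\le\eta$, and $\max(|\langle g_\chi,g_{\chi'}\rangle|,\langle g_\chi,g_{\chi'}\rangle_{U^{k+1}})\le\mathcal{D}(\eta,m)$ for all $\chi\ne\chi'$ in $S$. Nilspaces. A cube morphism $\{0,1\}^m\to\{0,1\}^n$ is the restriction of an affine homomorphism $\mathbb{Z}^m\to\mathbb{Z}^n$. A nilspace is a set $X$ with sets $C^n(X)\subset X^{\{0,1\}^n}$, $n\ge0$ ($n$-cubes), such that: $c\circ\psi\in C^m(X)$ for every $c\in C^n(X)$ and cube morphism $\psi:\{0,1\}^m\to\{0,1\}^n$; $C^1(X)=X^{\{0,1\}}$; and any $c':\{0,1\}^n\setminus\{1^n\}\to X$ whose restriction to each face $\{v:v_i=0\}$ is an $(n-1)$-cube extends to an $n$-cube. It is $k$-step if this extension is unique for $n=k+1$. A morphism is a map sending cubes to cubes by composition. For an abelian group $A$, $\mathcal{D}_j(A)$ is the nilspace on $A$ whose $n$-cubes are the maps $c:\{0,1\}^n\to A$ with $\sum_{v\in\{0,1\}^{j+1}}(-1)^{|v|}c(\psi(v))=0$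 for all cube morphisms $\psi:\{0,1\}^{j+1}\to\{0,1\}^n$. A finite abelian group $Z$ is viewed as $\mathcal{D}_1(Z)$, whose $n$-cubes are the maps $v\mapsto x+v_1t_1+\cdots+v_nt_n$. A compact nilspace is a nilspace with a compact Hausdorff second-countable topology with every $C^n(X)$ closed. Structure groups. For a $k$-step compact nilspace $X$ let $x\sim_jy$ iff there are $c,c'\in C^{j+1}(X)$ with $c(0)=x$, $c'(0)=y$ and $c=c'$ elsewhere; $X_j=X/\sim_j$ ($X_k=X$, $X_0$ a point). There are compact abelian groups $Z_j(X)$ (structure groups), $1\le j\le k$, with $Z_j(X)$ acting freely and continuously on $X_j$, orbits being the fibres of $X_j\to X_{j-1}$, and such that for $c\in C^n(X_j)$ the cubes in $C^n(X_j)$ with the same image in $X_{j-1}$ as $c$ are exactly $c+d$, $d\in C^n(\mathcal{D}_j(Z_j(X)))$. The action of $z\in Z_k(X)$ on $x\in X$ is written $x+z$. $X$ is a cfr (compact finite-rank) nilspace if all $Z_j(X)$ are Lie groups. The Haar measure $\mu_{C^n(X)}$ is the unique Borel probability measure on $C^n(X)$ defined recursively by being invariant under addition of elements of $C^n(\mathcal{D}_k(Z_k(X)))$ and projecting to $\mu_{C^n(X_{k-1})}$; for $Z$ finite, $\mu_{C^n(Z)}$ is uniform. $\widehat{Z_k(X)}$ is the character group of $Z_k(X)$. For bounded Borel $F:X\to\mathbb{C}$ and $\chi\in\widehat{Z_k(X)}$, $F_\chi(x)=\int_{Z_k(X)}F(x+z)\overline{\chi(z)}\,d\mu(z)$ ($\mu$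 the probability Haar measure on $Z_k(X)$). Fixed choices. An enumeration $Y_1,Y_2,\dots$ of the isomorphism classes of cfr nilspaces is fixed; $Y_i$ has complexity $i$. A $k$-step cfr nilspace is isomorphic to a quotient of a free nilspace $\prod_{i=1}^k\mathcal{D}_i(\mathbb{Z}^{a_i}\times\mathbb{R}^{b_i})$ by a $k$-th order lattice action, and is a smooth compact manifold with the structure making the quotient map a submersion; each $Y_i$ carries a fixed Riemannian metric tensor invariant under its last structure group, with $d(x,y)$ the geodesic distance within connected components and 1 across components; Lipschitz constants are with respect to $d$. For each $Y_i$ and $n$ a metric $d_n$ generating the weak topology on Borel probability measures on $C^n(Y_i)$ is fixed; $\phi:Z\to Y_i$ is $b$-balanced if $d_n\big(\mu_{C^n(Z)}\circ(\phi^{\{0,1\}^n})^{-1},\mu_{C^n(Y_i)}\big)\le b$ for every $n\le1/b$. For each $Y_i$, with last structure group $Z_k$, fix $Q_{Y_i}:\mathbb{R}_{>0}\times\mathbb{R}_{\ge0}\to\mathbb{N}$ such that for all $C,\delta'>0$ there is a set $S'\subset\widehat{Z_k}$ with $|S'|\le Q_{Y_i}(\delta',C)$ and $\|F-\sum_{\chi\in S'}F_\chi\|_\infty\le\delta'$ for every $C$-Lipschitz $F:Y_i\to\mathbb{C}$. Put $Q(\eta,m)=\max_{i\le m}Q_{Y_i}(\eta,m)$.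
   Formalization: For arbitrary η and D the claim fails (f=1, η≥1, F=0, f_e=f), so η and all D(η,m) are assumed below thresholds depending only on k and δ; the constant in Ω_δ(1) may depend on η, D and N, which are then to be chosen in terms of δ. *)

(* Defs.v *)
From HB Require Import structures.
From mathcomp Require Import all_boot all_order all_algebra finmap.
From mathcomp Require Import all_classical all_reals all_analysis.
From mathcomp Require Import complex.

Set Implicit Arguments.
Unset Strict Implicit.
Unset Printing Implicit Defensive.

Import numFieldNormedType.Exports.
Import Order.TTheory GRing.Theory Num.Theory.
Local Open Scope classical_set_scope.
Local Open Scope ring_scope.

(** * Discrete cubes and nilspaces *)

Definition cube (n : nat) := {ffun 'I_n -> bool}.
Definition cube0 n : cube n := [ffun=> false].
Definition cube1 n : cube n := [ffun=> true].
Definition weight n (v : cube n) : nat := (\sum_(i < n) v i)%N.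

Definition cube_morphism m n (psi : cube m -> cube n) : Prop :=
  exists (a : 'I_n -> int) (b : 'I_n -> 'I_m -> int), forall v i,
    (psi v i : nat)%:Z = a i + \sum_(j < m) b i j * (v j : nat)%:Z.

(* The identification of {0,1}^n with the face {v | v_i = 0} of {0,1}^(n+1). *)
Definition face0 n (i : 'I_n.+1) (v : cube n) : cube n.+1 :=
  [ffun j => if unlift i j is Some j' then v j' else false].

(* The carrier of a nilspace is nonempty (completion of the empty 0-corner), so
   a partial map on {0,1}^n minus 1^n is given as a total map whose value at
   1^n is ignored. *)
Record is_nilspace (T : Type) (C : forall n, set (cube n -> T)) : Prop := {
  nil_comp : forall m n (c : cube n -> T) (psi : cube m -> cube n),
    C n c -> cube_morphism psi -> C m (c \o psi);
  nil_ergodic : forall c : cube 1 -> T, C 1%N c;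
  nil_completion : forall n (c' : cube n.+1 -> T),
    (forall i, C n (c' \o face0 i)) ->
    exists c, C n.+1 c /\ forall v, v != cube1 n.+1 -> c v = c' v }.

Definition nil_step (T : Type) (C : forall n, set (cube n -> T)) (k : nat) :=
  forall c c' : cube k.+1 -> T, C k.+1 c -> C k.+1 c' ->
    (forall v, v != cube1 k.+1 -> c v = c' v) -> c = c'.

(* [dcube j A n] is the set of n-cubes of D_j(A). *)
Definition dcube (j : nat) (A : zmodType) (n : nat) : set (cube n -> A) :=
  [set c | forall psi : cube j.+1 -> cube n, cube_morphism psi ->
    \sum_(v : cube j.+1)
      (if odd (weight v) then - c (psi v) else c (psi v)) = 0].

(* The relation ~_j. *)
Definition nil_equiv (T : Type) (C : forall n, set (cube n -> T)) (j : nat)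
    (x y : T) : Prop :=
  exists c c' : cube j.+1 -> T, [/\ C j.+1 c, C j.+1 c',
    c (cube0 _) = x, c' (cube0 _) = y &
    forall v, v != cube0 _ -> c v = c' v].

(* The group Theta_i of translations of height i: applying [alpha] on a face of
   codimension i maps cubes to cubes. *)
Definition translation (T : Type) (C : forall n, set (cube n -> T)) (i : nat)
    (alpha : T -> T) : Prop :=
  forall n (I : {set 'I_n}) (w : cube n) (c : cube n -> T),
    #|I| = i -> C n c ->
    C n (fun v => if [forall j in I, v j == w j] then alpha (c v) else c v).

(** * Topology and Borel measures *)

(* T^({0,1}^n) with the product topology. *)
Definition cube_space (n : nat) (T : Type) := cube n -> T.
HB.instance Definition _ n (T : topologicalType) :=
  Topological.copy (cube_space n T) {ptws cube n -> T}.
HB.instance Definition _ n (T : pointedType) :=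
  isPointed.Build (cube_space n T) (fun=> point).

(* Measurable types are pointed in the library; a group is pointed by 0. *)
Definition group_space (A : topologicalZmodType) : Type := A.
HB.instance Definition _ (A : topologicalZmodType) :=
  Topological.copy (group_space A) A.
HB.instance Definition _ (A : topologicalZmodType) :=
  isPointed.Build (group_space A) (0 : A).

Notation borel T := (g_sigma_algebraType (@open T)).

Record compact_nilspace := CompactNilspace {
  cn_T :> ptopologicalType;
  cubes : forall n, set (cube n -> cn_T);
  cn_nilspace : is_nilspace cubes;
  cn_compact : compact [set: cn_T];
  cn_hausdorff : hausdorff_space cn_T;
  cn_countable : @second_countable cn_T;
  cn_closed : forall n, closed (@cubes n : set (cube_space n cn_T)) }.

Definition nil_iso (X Y : compact_nilspace) : Prop :=
  exists (f : X -> Y) (g : Y -> X), [/\ cancel f g, cancel g f,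
    continuous f, continuous g &
    forall n c, @cubes X n c <-> @cubes Y n (f \o c)].

(** * Smooth manifolds *)

Section Smooth.
Variable R : realType.

Fixpoint is_Cr (V W : normedModType R) (r : nat) (U : set V) (f : V -> W)
    : Prop :=
  (forall x, U x -> {for x, continuous f}) /\
  (if r is r'.+1 then
     forall v : V, (forall x, U x -> derivable f x v) /\
                   is_Cr r' U (fun x => 'D_v f x)
   else True).

Definition smooth_on (V W : normedModType R) (U : set V) (f : V -> W) :=
  forall r, is_Cr r U f.

(* [chart_to] is meaningful on [dom], [chart_from] on its image [cod]. *)
Record chart (T : topologicalType) (n : nat) := Chart {
  dom : set T;
  chart_to : T -> 'rV[R]_n;
  chart_from : 'rV[R]_n -> T }.

Definition cod (T : topologicalType) n (c : chart T n) : set 'rV[R]_n := chart_to c @` dom c.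

Definition is_chart (T : topologicalType) n (c : chart T n) : Prop :=
  [/\ open (dom c), open (cod c),
      forall x, dom c x -> chart_from c (chart_to c x) = x,
      forall x, dom c x -> {for x, continuous (chart_to c)} &
      forall y, cod c y -> {for y, continuous (chart_from c)}].

(* The expression of h : T -> T in charts, and its domain of definition. *)
Definition local_rep (T : topologicalType) n (h : T -> T) (c1 c2 : chart T n) (y : 'rV[R]_n) :=
  chart_to c2 (h (chart_from c1 y)).
Definition local_dom (T : topologicalType) n (h : T -> T) (c1 c2 : chart T n) : set 'rV[R]_n :=
  [set y | cod c1 y /\ dom c2 (h (chart_from c1 y))].

Definition smooth_atlas (T : topologicalType) n (A : set (chart T n)) : Prop :=
  [/\ forall c, A c -> is_chart c,
      forall x, exists2 c, A c & dom c x &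
      forall c1 c2, A c1 -> A c2 ->
        smooth_on (local_dom id c1 c2) (local_rep id c1 c2)].

Definition is_lie_group (G : topologicalZmodType) : Prop :=
  exists (n : nat) (A : set (chart G n)), smooth_atlas A /\
    forall c1 c2 c3, A c1 -> A c2 -> A c3 ->
      smooth_on
        [set p : 'rV[R]_n * 'rV[R]_n | [/\ cod c1 p.1, cod c2 p.2 &
           dom c3 (chart_from c1 p.1 - chart_from c2 p.2)]]
        (fun p : 'rV[R]_n * 'rV[R]_n =>
           chart_to c3 (chart_from c1 p.1 - chart_from c2 p.2)).

Definition mxform n (M : 'M[R]_n) (v w : 'rV[R]_n) : R :=
  (v *m M *m w^T) ord0 ord0.

(* [g c y] is the Gram matrix of the metric tensor in the chart c, at the point
   with coordinates y.  With h := id this says how g changes with the chart. *)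
Definition smooth_isometry (T : topologicalType) n (A : set (chart T n))
    (g : chart T n -> 'rV[R]_n -> 'M[R]_n) (h : T -> T) : Prop :=
  forall c1 c2, A c1 -> A c2 ->
    smooth_on (local_dom h c1 c2) (local_rep h c1 c2) /\
    forall y v w, local_dom h c1 c2 y ->
      mxform (g c1 y) v w =
      mxform (g c2 (local_rep h c1 c2 y))
        ('D_v (local_rep h c1 c2) y) ('D_w (local_rep h c1 c2) y).

Record riemannian (T : topologicalType) := Riemannian {
  rm_dim : nat;
  rm_atlas : set (chart T rm_dim);
  rm_metric : chart T rm_dim -> 'rV[R]_rm_dim -> 'M[R]_rm_dim;
  rm_manifold : smooth_atlas rm_atlas;
  rm_smooth : forall c, rm_atlas c -> smooth_on (cod c) (rm_metric c);
  rm_sym : forall c y, rm_atlas c -> cod c y ->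
    (rm_metric c y)^T = rm_metric c y;
  rm_pos : forall c y v, rm_atlas c -> cod c y -> v != 0 ->
    0 < mxform (rm_metric c y) v v;
  rm_change : smooth_isometry rm_atlas rm_metric id }.

Arguments rm_atlas {T} r _.
Arguments rm_metric {T} r _ _.

(* Lengths of piecewise C^1 paths from x to y, cut into pieces lying each in a
   single chart. *)
Inductive path_length (T : topologicalType) (M : riemannian T) :
    T -> T -> R -> Prop :=
| path_nil x : path_length M x x 0
| path_cons (c : chart T (rm_dim M)) (u : R -> 'rV[R]_(rm_dim M)) y L :
    rm_atlas M c ->
    is_Cr 1 [set: R] u ->
    (forall t, 0 <= t <= 1 -> cod c (u t)) ->
    path_length M (chart_from c (u 1)) y L ->
    path_length M (chart_from c (u 0)) y
      (\int[lebesgue_measure]_(t in `[0, 1])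
         Num.sqrt (mxform (rm_metric M c (u t)) ('D_1 u t) ('D_1 u t)) + L).

Definition geo_dist (T : topologicalType) (M : riemannian T) (x y : T) : R :=
  if `[< connected_component [set: T] x y >]
  then inf [set L | path_length M x y L] else 1.

End Smooth.

Arguments rm_atlas {R T} r _.
Arguments rm_metric {R T} r _ _.

(** * Compact finite-rank nilspaces *)

Section CFR.
Variable R : realType.

(* The factors X_j (as quotient spaces of X) and the structure groups Z_j(X).
   The data at j = 0 other than X_0 are irrelevant. *)
Record structure_tower (X : compact_nilspace) := StructureTower {
  fac : nat -> topologicalType;
  fproj : forall j, X -> fac j;
  fproj_eq : forall j x y,
    fproj j x = fproj j y <-> nil_equiv (@cubes X) j x y;
  fproj_surj : forall j w, exists x, fproj j x = w;
  fproj_open : forall j (U : set (fac j)), open U <-> open (fproj j @^-1` U);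
  sgroup : nat -> topologicalZmodType;
  sgroup_compact : forall j, compact [set: sgroup j];
  sgroup_hausdorff : forall j, hausdorff_space (sgroup j);
  sact : forall j, fac j -> sgroup j -> fac j;
  sact0 : forall j w, sact (j := j.+1) w 0 = w;
  sactD : forall j w z z', sact (j := j.+1) w (z + z') = sact (sact w z) z';
  sact_free : forall j w z, sact (j := j.+1) w z = w -> z = 0;
  sact_continuous : forall j,
    continuous (fun p : fac j.+1 * sgroup j.+1 => sact p.1 p.2);
  sact_orbit : forall j x y, (exists z, sact (fproj j.+1 x) z = fproj j.+1 y)
    <-> fproj j x = fproj j y;
  sact_cubes : forall j n (c : cube n -> X) (c' : cube n -> fac j.+1),
    @cubes X n c ->
    (exists b : cube n -> X, [/\ @cubes X n b,
       forall v, fproj j.+1 (b v) = c' v &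
       forall v, fproj j (b v) = fproj j (c v)])
    <-> (exists2 d : cube n -> sgroup j.+1, dcube j.+1 d &
       forall v, c' v = sact (fproj j.+1 (c v)) (d v)) }.

(* The recursive characterization of the Haar measure on C^n(X), unfolded: mu is
   carried by C^n(X), and for every j >= 1 its image on C^n(X_j) is invariant
   under C^n(D_j(Z_j)).  The images on consecutive factors are compatible since
   they are all images of mu. *)
Definition is_cube_haar (X : compact_nilspace) (W : structure_tower X) n
    (mu : probability (borel (cube_space n X)) R) : Prop :=
  mu (@cubes X n) = 1%E /\
  forall j (d : cube n -> sgroup W j.+1), dcube j.+1 d ->
  forall B : set (cube_space n (fac W j.+1)), <<s @open _ >> B ->
    mu [set c | B (fun v => sact (fproj W j.+1 (c v)) (d v))] =
    mu [set c | B (fun v => fproj W j.+1 (c v))].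

Record cfr_nilspace := CfrNilspace {
  cfr_X :> compact_nilspace;
  cfr_step : nat;
  cfr_stepP : nil_step (@cubes cfr_X) cfr_step;
  cfr_step_min : forall s, nil_step (@cubes cfr_X) s -> (cfr_step <= s)%N;
  cfr_tower :> structure_tower cfr_X;
  cfr_lie : forall j, is_lie_group R (sgroup cfr_tower j.+1);
  haar : forall j,
    probability (borel (group_space (sgroup cfr_tower j))) R;
  haar_inv : forall j (z : sgroup cfr_tower j)
      (B : set (group_space (sgroup cfr_tower j))), <<s @open _ >> B ->
    haar j [set x : sgroup cfr_tower j | B (x + z)] = haar j B;
  cube_haar : forall n, probability (borel (cube_space n cfr_X)) R;
  cube_haarP : forall n, is_cube_haar cfr_tower (cube_haar n) }.

(* The action x + z of the last structure group on a k-step X: X_k = X, so the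
   defining equation in X_k determines x + z. *)
Definition act_last (X : cfr_nilspace) (k : nat) (x : X) (z : sgroup X k) : X :=
  xget x [set y | fproj X k y = sact (fproj X k x) z].

Definition cabs (z : R[i]) : R := ComplexField.Normc.normc z.

Definition is_character (G : topologicalZmodType) (chi : G -> R[i]) : Prop :=
  [/\ forall x y, chi (x + y) = chi x * chi y,
      forall x, cabs (chi x) = 1,
      continuous (fun x => complex.Re (chi x)) &
      continuous (fun x => complex.Im (chi x))].

Definition fourier_comp (X : cfr_nilspace) (k : nat) (F : X -> R[i])
    (chi : sgroup X k -> R[i]) (x : X) : R[i] :=
  let h z := F (act_last x z) * (chi z)^*%C in
  Complex (\int[haar X k]_z complex.Re (h z)) (\int[haar X k]_z complex.Im (h z)).

(* [d] is a metric on Borel probability measures on C^n(X), i.e. measures on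
   X^({0,1}^n) carried by the closed set C^n(X), and it generates the weak
   topology.  Every continuous function on C^n(X) extends to X^({0,1}^n). *)
Definition generates_weak_topology (X : cfr_nilspace) n
    (d : probability (borel (cube_space n X)) R ->
         probability (borel (cube_space n X)) R -> R) : Prop :=
  let P := [set mu : probability (borel (cube_space n X)) R |
              mu (@cubes X n) = 1%E] in
  let I (mu : probability (borel (cube_space n X)) R)
        (h : cube_space n X -> R) := \int[mu]_c h c in
  [/\ forall mu nu, P mu -> P nu -> 0 <= d mu nu /\ d mu nu = d nu mu,
      forall mu nu, P mu -> P nu ->
        (d mu nu = 0 <-> forall B, measurable B -> mu B = nu B),
      forall mu nu la, P mu -> P nu -> P la -> d mu la <= d mu nu + d nu la,
      forall mu h e, P mu -> continuous h -> 0 < e ->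
        exists2 r, 0 < r & forall nu, P nu -> d mu nu < r ->
          `|I mu h - I nu h| < e &
      forall mu r, P mu -> 0 < r ->
        exists (p : nat) (h : 'I_p -> cube_space n X -> R) (e : R),
          [/\ forall i, continuous (h i), 0 < e &
              forall nu, P nu -> (forall i, `|I mu (h i) - I nu (h i)| < e) ->
                d mu nu < r]].

(** ** Presentation of a cfr nilspace as a quotient of a free nilspace *)

(* prod_i D_i(Z^(a_i) x R^(b_i)): [da s] and [db t] are the degrees i of the
   integer coordinate s and of the real coordinate t. *)
Definition free_space (A B : nat) : Type := ('rV[int]_A * 'rV[R]_B)%type.

Definition free_cubes A B (da : 'I_A -> nat) (db : 'I_B -> nat) n :
    set (cube n -> free_space A B) :=
  [set c : cube n -> free_space A B |
    (forall s, dcube (da s) (fun v => (c v).1 ord0 s)) /\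
    (forall t, dcube (db t) (fun v => (c v).2 ord0 t))].

(* Continuity for the topology of Z^A x R^B. *)
Definition free_continuous A B (g : free_space A B -> free_space A B) : Prop :=
  forall (z : 'rV[int]_A) (x : 'rV[R]_B),
    {for x, continuous (fun x' => (g (z, x')).2)} /\
    \forall x' \near x, (g (z, x')).1 = (g (z, x)).1.

(* Elements of Z_i = Z^(a_i) x R^(b_i), as vectors supported in degree i. *)
Definition free_degree A B (da : 'I_A -> nat) (db : 'I_B -> nat) (i : nat) :
    set (free_space A B) :=
  [set l : free_space A B | (forall s, da s != i -> l.1 ord0 s = 0) /\
                            (forall t, db t != i -> l.2 ord0 t = 0)].

(* The shifts of the degree i coordinates by elements of Gamma of height i. *)
Definition lattice_shifts A B (da : 'I_A -> nat) (db : 'I_B -> nat)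
    (Gamma : set (free_space A B -> free_space A B)) (i : nat) :
    set (free_space A B) :=
  [set l : free_space A B | free_degree da db i l /\
    exists g, [/\ Gamma g, translation (free_cubes da db) i g &
      forall p : free_space A B,
        (forall s, da s = i -> (g p).1 ord0 s = p.1 ord0 s + l.1 ord0 s) /\
        (forall t, db t = i -> (g p).2 ord0 t = p.2 ord0 t + l.2 ord0 t)]].

(* A k-th order lattice action: a fibre-transitive group of translations which
   induces on each structure group Z_i a lattice (discrete and cocompact). *)
Record lattice_action A B (da : 'I_A -> nat) (db : 'I_B -> nat) (k : nat)
    (Gamma : set (free_space A B -> free_space A B)) : Prop := {
  la_id : Gamma id;
  la_comp : forall g h, Gamma g -> Gamma h -> Gamma (g \o h);
  la_inv : forall g, Gamma g -> exists h, [/\ Gamma h, cancel g h & cancel h g];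
  la_translation : forall g, Gamma g ->
    translation (free_cubes da db) 1 g /\ free_continuous g;
  la_fibre_transitive : forall i g p, (i < k)%N -> Gamma g ->
    nil_equiv (free_cubes da db) i p (g p) ->
    exists h, [/\ Gamma h, translation (free_cubes da db) i.+1 h & h p = g p];
  la_discrete : forall i, (1 <= i <= k)%N ->
    exists2 e : R, 0 < e &
      forall l : free_space A B, lattice_shifts da db Gamma i l ->
      l.1 = 0 -> `|l.2| < e -> l.2 = 0;
  la_cocompact : forall i, (1 <= i <= k)%N ->
    exists M : R, forall w : free_space A B, free_degree da db i w ->
      exists l : free_space A B, [/\ lattice_shifts da db Gamma i l,
        forall s, `|w.1 ord0 s - l.1 ord0 s|%:~R <= M & `|w.2 - l.2| <= M] }.

(* Y is the quotient of a free nilspace by a k-th order lattice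
   action, as a topological nilspace, and the quotient map is a submersion for
   the given smooth structure. *)
Definition free_quotient (Y : cfr_nilspace) (M : riemannian R Y) : Prop :=
  exists (A B : nat) (da : 'I_A -> nat) (db : 'I_B -> nat)
    (Gamma : set (free_space A B -> free_space A B)) (q : free_space A B -> Y),
  (forall s, (1 <= da s <= cfr_step Y)%N) /\
  (forall t, (1 <= db t <= cfr_step Y)%N) /\
  lattice_action da db (cfr_step Y) Gamma /\
  [/\ forall y, exists p, q p = y,
      forall p p', q p = q p' <-> exists2 g, Gamma g & g p = p',
      forall n c, @cubes Y n c <->
        exists2 b, @free_cubes _ _ da db n b & c = q \o b,
      forall U : set Y, open U <->
        forall z : 'rV[int]_A, open [set x : 'rV[R]_B | U (q (z, x))] &
      forall (z : 'rV[int]_A) c, rm_atlas M c ->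
        let U := [set x : 'rV[R]_B | dom c (q (z, x))] in
        let f := (fun x : 'rV[R]_B => chart_to c (q (z, x))) in
        smooth_on U f /\
        forall x, U x -> forall w, exists v, 'D_v f x = w].

Definition lipschitz (Y : cfr_nilspace) (M : riemannian R Y) (L : R)
    (F : Y -> R[i]) : Prop :=
  forall x y, cabs (F x - F y) <= L * geo_dist M x y.

(** * The fixed choices *)

(* [Yenum i] is the cfr nilspace of complexity i.+1.  A k-step nilspace is also
   k'-step for k' >= k; [Qbound] refers to the group Z_k(Y) for any k for which Y
   is k-step (Z_k(Y) is trivial unless k is the exact step). *)
Record fixed_choices := FixedChoices {
  Yenum : nat -> cfr_nilspace;
  Yenum_surj : forall X : cfr_nilspace, exists i, nil_iso X (Yenum i);
  Yenum_inj : forall i j, nil_iso (Yenum i) (Yenum j) -> i = j;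
  Ymetric : forall i, riemannian R (Yenum i);
  Ysubmersion : forall i, free_quotient (Ymetric i);
  Yinvariant : forall i (z : sgroup (Yenum i) (cfr_step (Yenum i))),
    (0 < cfr_step (Yenum i))%N ->
    smooth_isometry (rm_atlas (Ymetric i)) (rm_metric (Ymetric i))
      (fun x => act_last x z);
  wdist : forall i n, probability (borel (cube_space n (Yenum i))) R ->
    probability (borel (cube_space n (Yenum i))) R -> R;
  wdistP : forall i n, generates_weak_topology (@wdist i n);
  Qbound : nat -> R -> R -> nat;
  QboundP : forall i k (C delta' : R), (0 < k)%N ->
    nil_step (@cubes (Yenum i)) k -> 0 < C -> 0 < delta' ->
    exists S' : {fset (sgroup (Yenum i) k -> R[i])},
      [/\ forall chi, chi \in S' -> is_character chi,
          (#|` S'| <= Qbound i delta' C)%N &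
          forall F, lipschitz (Ymetric i) C F -> forall x,
            cabs (F x - \sum_(chi <- S') fourier_comp F chi x) <= delta'] }.

Definition Qmax (ch : fixed_choices) (eta : R) (m : nat) : nat :=
  (\max_(i < m) Qbound ch i eta m%:R)%N.

End CFR.

(** * Finite abelian groups and uniformity norms *)

Section Finite.
Variables (R : realType) (Z : finZmodType).
Implicit Types f g : Z -> R[i].

Definition mean (I : finType) (u : I -> R[i]) : R[i] :=
  (#|I|%:R)^-1 * \sum_i u i.

Definition inner f g : R[i] := mean (fun x => f x * (g x)^*%C).

Definition norm1 f : R := (#|Z|%:R)^-1 * \sum_x cabs (f x).

Definition bounded_by (X : Type) (u : X -> R[i]) (b : R) : Prop :=
  forall x, cabs (u x) <= b.

Definition group_cube n (x : Z) (t : {ffun 'I_n -> Z}) (v : cube n) : Z :=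
  x + \sum_(i < n) t i *+ v i.

Definition gowers_form n (f_ : cube n -> Z -> R[i]) : R[i] :=
  mean (fun p : Z * {ffun 'I_n -> Z} => \prod_(v : cube n)
    let w := f_ v (group_cube p.1 p.2 v) in
    if odd (weight v) then w^*%C else w).

(* The form is a nonnegative real when n > 0. *)
Definition gowers_norm n f : R :=
  (complex.Re (gowers_form (fun _ : cube n => f))) `^ ((2 ^ n)%:R)^-1.

Definition gowers_inner n f g : R[i] :=
  gowers_form (fun v : cube n.+1 => if v ord_max then g else f).

Definition nil_morphism (Y : compact_nilspace) (phi : Z -> Y) : Prop :=
  forall n x t, @cubes Y n (phi \o @group_cube n x t).

(* The image of the uniform measure on C^n(Z) under phi^({0,1}^n): the average of
   the Dirac measures at the cubes phi(x + v.t), over all x and t. *)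
Section Push.
Variables (Y : compact_nilspace) (phi : Z -> Y) (n : nat).

Let param := (Z * {ffun 'I_n -> Z})%type.
Let card_inv_ge0 : 0 <= (#|{: param}|%:R)^-1 :> R.
Proof. by rewrite invr_ge0. Qed.

Definition push_sum : set (borel (cube_space n Y)) -> \bar R :=
  msum (fun k => let p : param := nth (0, [ffun=> 0]) (enum {: param}) k in
    \d_(phi \o group_cube p.1 p.2 : borel (cube_space n Y))) #|{: param}|.
HB.instance Definition _ := Measure.on push_sum.

Definition push_cubes : set (borel (cube_space n Y)) -> \bar R :=
  mscale (NngNum card_inv_ge0) push_sum.
HB.instance Definition _ := Measure.on push_cubes.

Let push_cubesT : push_cubes setT = 1%E.
Proof.
have -> : push_cubes setT =
    ((#|{: param}|%:R)^-1%:E * \sum_(i < #|{: param}|) 1)%E :> \bar R.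
  by congr (_ * _)%E; apply: eq_bigr => i _; exact: diracT.
rewrite sumEFin -EFinM sumr_const card_ord mulVf // pnatr_eq0 -lt0n.
by apply/card_gt0P; exists (0, [ffun=> 0]).
Qed.
HB.instance Definition _ :=
  Measure_isProbability.Build _ _ _ push_cubes push_cubesT.

End Push.

Arguments push_cubes {Y} phi n _.

Variables (ch : fixed_choices R) (k : nat) (D : R -> nat -> R) (eta : R).

Definition balanced i (b : R) (phi : Z -> Yenum ch i) : Prop :=
  forall n : nat, n%:R <= b^-1 ->
    wdist (push_cubes phi n) (cube_haar (Yenum ch i) n) <= b.

(* The data provided by the regularity theorem for f, with complexity bound m. *)
Record regularity_data (m : nat) (f : Z -> R[i]) := RegularityData {
  rd_i : nat;
  rd_complexity : (rd_i.+1 <= m)%N;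
  rd_step : nil_step (@cubes (Yenum ch rd_i)) k;
  rd_phi : Z -> Yenum ch rd_i;
  rd_morphism : nil_morphism rd_phi;
  rd_balanced : balanced (D eta m) rd_phi;
  rd_F : Yenum ch rd_i -> R[i];
  rd_F_bounded : bounded_by rd_F 1;
  rd_F_lipschitz : lipschitz (Ymetric ch rd_i) m%:R rd_F;
  rd_fe : Z -> R[i];
  rd_fr : Z -> R[i];
  rd_fs : Z -> R[i] := rd_F \o rd_phi;
  rd_decomposition : forall x, f x = rd_fs x + rd_fe x + rd_fr x;
  rd_fe_small : norm1 rd_fe <= eta;
  rd_fr_bounded : bounded_by rd_fr 1;
  rd_fr_small : Num.max (gowers_norm k.+1 rd_fr)
    (Num.max (cabs (inner rd_fr rd_fs)) (cabs (inner rd_fr rd_fe))) <= D eta m;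
  rd_S : {fset (sgroup (Yenum ch rd_i) k -> R[i])};
  rd_S_char : forall chi, chi \in rd_S -> is_character chi;
  rd_S_card : (#|` rd_S| <= Qmax ch eta m)%N;
  rd_g : (sgroup (Yenum ch rd_i) k -> R[i]) -> Z -> R[i] :=
    fun chi => fourier_comp rd_F chi \o rd_phi;
  rd_ge : Z -> R[i];
  rd_fourier : forall x, rd_fs x = \sum_(chi <- rd_S) rd_g chi x + rd_ge x;
  rd_ge_small : bounded_by rd_ge eta;
  rd_orthogonal : forall chi chi', chi \in rd_S -> chi' \in rd_S ->
    chi != chi' ->
    cabs (inner (rd_g chi) (rd_g chi')) <= D eta m /\
    gowers_inner k (rd_g chi) (rd_g chi') <= (D eta m)%:C%C }.

End Finite.

Arguments rd_S {R Z ch k D eta m f} r.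
Arguments rd_g {R Z ch k D eta m f} r chi _.

(* N is a number as provided by the regularity theorem for eta and D. *)
Definition regularity_number (R : realType) (ch : fixed_choices R) (k : nat)
    (D : R -> nat -> R) (eta : R) (N : nat) : Prop :=
  (0 < N)%N /\
  forall (Z : finZmodType) (f : Z -> R[i]), bounded_by f 1 ->
    exists2 m : nat, (1 <= m <= N)%N &
      inhabited (regularity_data ch k D eta m f).

(* Main.v *)
(** For functions bounded by 1, the Cauchy-Schwarz inequality for the Gowers
form gives |<f_v>_v| <= ||f_w||_{U^n} for every vertex w.  Put n = k+1.
Replacing f by f_s one vertex at a time in <f,...,f> = ||f||_{U^n}^(2^n)
therefore costs at most
2^n (||f_e||_1 + ||f_r||_{U^n}), while <f_s,...,f_s> <= ||f_s||_2^2 because f_s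
is bounded by 1.  Finally ||f_s||_2^2 differs from <f, f_s> by at most
||f_e||_1 + |<f_r, f_s>|, and <f, f_s> is the sum of the <f, g_chi> up to
||g_e||_oo, so the sum over S of |<f, g_chi>| is at least delta^(2^n)/2.  The
errors do not involve |S|, hence the thresholds on eta and D depend on delta
and k only. *)

Require Import Defs.
From HB Require Import structures.
From mathcomp Require Import all_boot all_order all_algebra finmap.
From mathcomp Require Import all_classical all_reals all_analysis.
From mathcomp Require Import complex ring lra.
Import numFieldNormedType.Exports.
Import Order.TTheory GRing.Theory Num.Theory.
Local Open Scope ring_scope.

Set Implicit Arguments.
Unset Strict Implicit.
Unset Printing Implicit Defensive.

(** * Averages over finite types and the Cauchy-Schwarz inequality *)

Section Means.
Variable R : realType.
Implicit Types I J : finType.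

Lemma eq_mean I (u v : I -> R[i]) : u =1 v -> mean u = mean v.
Proof. by move=> uv; congr (_ * _); apply: eq_bigr. Qed.

Lemma le_mean I (u v : I -> R[i]) : (forall i, u i <= v i) -> mean u <= mean v.
Proof. by move=> uv; apply: ler_wpM2l; rewrite ?invr_ge0 ?ler0n ?ler_sum. Qed.

Lemma mean_ge0 I (u : I -> R[i]) : (forall i, 0 <= u i) -> 0 <= mean u.
Proof. by move=> u0; rewrite mulr_ge0 ?sumr_ge0 // invr_ge0 ler0n. Qed.

Lemma norm_mean I (u : I -> R[i]) : `|mean u| <= mean (fun i => `|u i|).
Proof.
rewrite normrM ger0_norm ?invr_ge0 ?ler0n //.
by rewrite ler_wpM2l ?ler_norm_sum // invr_ge0 ler0n.
Qed.

Lemma meanD I (u v : I -> R[i]) : mean (fun i => u i + v i) = mean u + mean v.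
Proof. by rewrite /mean big_split mulrDr. Qed.

Lemma meanB I (u v : I -> R[i]) : mean (fun i => u i - v i) = mean u - mean v.
Proof. by rewrite /mean big_split sumrN mulrDr mulrN. Qed.

Lemma mean_sum I (T : Type) (s : seq T) (u : T -> I -> R[i]) :
  mean (fun i => \sum_(j <- s) u j i) = \sum_(j <- s) mean (u j).
Proof. by rewrite /mean exchange_big mulr_sumr. Qed.

Lemma meanMl I (a : R[i]) (u : I -> R[i]) :
  mean (fun i => a * u i) = a * mean u.
Proof. by rewrite /mean -mulr_sumr mulrCA. Qed.

Lemma meanMr I (u : I -> R[i]) (a : R[i]) :
  mean (fun i => u i * a) = mean u * a.
Proof. by rewrite /mean -mulr_suml mulrA. Qed.

Lemma mean_conj I (u : I -> R[i]) : mean (fun i => (u i)^*%C) = ((mean u)^*)%C.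
Proof.
by rewrite /mean rmorphM fmorphV rmorph_nat rmorph_sum.
Qed.

Lemma mean_cst I (a : R[i]) : (0 < #|I|)%N -> mean (fun _ : I => a) = a.
Proof.
move=> I0; rewrite /mean sumr_const -[a *+ _]mulr_natl mulKf //.
by rewrite pnatr_eq0 -lt0n.
Qed.

Lemma mean_bij I J (h : I -> J) (u : J -> R[i]) :
  bijective h -> mean (u \o h) = mean u.
Proof.
move=> hb; rewrite /mean (bij_eq_card hb); congr (_ * _).
by rewrite [RHS](reindex h) //; exact: onW_bij.
Qed.

Lemma mean_pair I J (u : I -> J -> R[i]) :
  mean (fun p : I * J => u p.1 p.2) = mean (fun i => mean (u i)).
Proof.
rewrite /mean -mulr_sumr pair_bigA card_prod natrM invfM.
by rewrite mulrA.
Qed.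

Lemma mean_exchange I J (u : I -> J -> R[i]) :
  mean (fun i => mean (u i)) = mean (fun j => mean (u^~ j)).
Proof. by rewrite /mean -!mulr_sumr exchange_big mulrCA. Qed.

(** The triangle inequality reduces to absolute values. Lagrange's identity then writes twice the
    difference of the two sides as a double average of squares. *)
Lemma mean_CauchySchwarz I (u v : I -> R[i]) :
  `|mean (fun i => u i * (v i)^*%C)| ^+ 2 <=
  mean (fun i => `|u i| ^+ 2) * mean (fun i => `|v i| ^+ 2).
Proof.
apply: (@le_trans _ _ (mean (fun i => `|u i| * `|v i|) ^+ 2)).
  apply: lerXn2r; rewrite ?nnegrE ?normr_ge0 //.
    by apply: mean_ge0 => i; exact: mulr_ge0.
  apply: (le_trans (norm_mean _)); apply: le_mean => i.
  by rewrite normrM normcJ.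
have : 0 <= mean (fun i => mean (fun j =>
    (`|u i| * `|v j| - `|u j| * `|v i|) ^+ 2)).
  apply: mean_ge0 => i; apply: mean_ge0 => j.
  (* The order on [R[i]] is partial: the square is nonnegative because its base is real. *)
  by rewrite real_exprn_even_ge0 // rpredB // rpredM // normr_real.
have -> : mean (fun i => mean (fun j =>
    (`|u i| * `|v j| - `|u j| * `|v i|) ^+ 2)) =
  (mean (fun i => `|u i| ^+ 2) * mean (fun i => `|v i| ^+ 2)
   - mean (fun i => `|u i| * `|v i|) ^+ 2) *+ 2.
  transitivity (mean (fun i => (`|u i| ^+ 2 * mean (fun j => `|v j| ^+ 2)
    + mean (fun j => `|u j| ^+ 2) * `|v i| ^+ 2)
    - (2 * mean (fun j => `|u j| * `|v j|)) * (`|u i| * `|v i|))).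
    apply: eq_mean => i.
    rewrite -[X in X + _ - _]meanMl -[X in _ + X - _]meanMr.
    rewrite -[X in _ - X * _]meanMl -[X in _ - X]meanMr -meanD -meanB.
    by apply: eq_mean => j; ring.
  by rewrite meanB meanD meanMr !meanMl; ring.
by rewrite pmulrn_lge0 // subr_ge0.
Qed.
End Means.

(** * Gowers forms of families indexed by the vertices, and the Gowers-Cauchy-Schwarz inequality *)

Section GowersForm.
Variables (R : realType) (Z : finZmodType) (n : nat).
Implicit Types (f : cube n -> Z -> R[i]) (v w : cube n) (t : {ffun 'I_n -> Z}).

Definition twist v (z : R[i]) : R[i] := if odd (weight v) then z^*%C else z.

Lemma norm_twist v z : `|twist v z| = `|z|.
Proof. by rewrite /twist; case: ifP => // _; exact: normcJ. Qed.

Lemma gowers_formE f : gowers_form f =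
  mean (fun p : Z * {ffun 'I_n -> Z} =>
    \prod_v twist v (f v (group_cube p.1 p.2 v))).
Proof. by []. Qed.

Lemma eq_gowers_form f g :
  (forall v x, f v x = g v x) -> gowers_form f = gowers_form g.
Proof.
by move=> fg; apply: eq_mean => p; apply: eq_bigr => v _; rewrite fg.
Qed.

(** For fixed [t] the vertex at [v] is a translate of [x], hence uniformly distributed. *)
Lemma mean_group_cube v (u : Z -> R[i]) :
  mean (fun p : Z * {ffun 'I_n -> Z} => u (group_cube p.1 p.2 v)) = mean u.
Proof.
rewrite (mean_pair (fun x t => u (group_cube x t v))) mean_exchange.
rewrite -[RHS](@mean_cst R {ffun 'I_n -> Z}); last first.
  by apply/card_gt0P; exists 0.
apply: eq_mean => t; rewrite -(mean_bij u (h := fun x => group_cube x t v)) //.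
exists (fun x => x - \sum_(i < n) t i *+ v i) => x.
  by rewrite /group_cube addrK.
by rewrite /group_cube subrK.
Qed.

Definition set_coord (i : 'I_n) (b : bool) v : cube n :=
  [ffun j => if j == i then b else v j].

Lemma set_coord_id i b v : v i = b -> set_coord i b v = v.
Proof. by move=> vi; apply/ffunP => j; rewrite ffunE; case: eqP => // ->. Qed.

Lemma set_coordK i b c v : set_coord i b (set_coord i c v) = set_coord i b v.
Proof. by apply/ffunP => j; rewrite !ffunE; case: eqP. Qed.

Lemma set_coord_at i b v : set_coord i b v i = b.
Proof. by rewrite ffunE eqxx. Qed.

Lemma weight_set_coord i v :
  ~~ v i -> weight (set_coord i true v) = (weight v).+1.
Proof.
move=> /negbTE vi; rewrite /weight (bigD1 i) //= [in RHS](bigD1 i) //=.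
rewrite set_coord_at vi add0n add1n; congr _.+1.
by apply: eq_bigr => j /negbTE ji; rewrite ffunE ji.
Qed.

Lemma group_cube_set_coord i v x t : ~~ v i ->
  group_cube x t (set_coord i true v) = group_cube (x + t i) t v.
Proof.
move=> /negbTE vi; rewrite /group_cube (bigD1 i) //= [in RHS](bigD1 i) //=.
rewrite set_coord_at vi mulr1n mulr0n add0r addrA; congr (_ + _).
by apply: eq_bigr => j /negbTE ji; rewrite ffunE ji.
Qed.

Lemma group_cube_shift i v x t s : ~~ v i ->
  group_cube x (t + [ffun j => if j == i then s else 0]) v = group_cube x t v.
Proof.
move=> /negbTE vi; congr (_ + _); apply: eq_bigr => j _; rewrite !ffunE.
by case: eqP => [->|_]; rewrite ?vi ?mulr0n ?addr0.
Qed.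

(* The average over x of the product over the face v_i = 0 of the functions
   attached to the face v_i = b; it does not depend on t_i. *)
Definition slice f i b t : R[i] :=
  mean (fun x => \prod_(v : cube n | ~~ v i)
    twist v (f (set_coord i b v) (group_cube x t v))).

(** The face v_i = 1 is the face v_i = 0 based at x + t_i, with one more conjugation on every
    factor. As the face products do not otherwise involve t_i, the base points x and x + t_i can be
    averaged independently. *)
Lemma gowers_form_slice f i : gowers_form f =
  mean (fun t => slice f i false t * (slice f i true t)^*%C).
Proof.
pose A b x t := \prod_(v : cube n | ~~ v i)
  twist v (f (set_coord i b v) (group_cube x t v)).
have A_shift b x t s :
    A b x (t + [ffun j => if j == i then s else 0]) = A b x t.
  by apply: eq_bigr => v vi; rewrite group_cube_shift.
transitivity (mean (fun x => mean (fun t =>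
    A false x t * (A true (x + t i) t)^*%C))).
  rewrite gowers_formE -mean_pair; apply: eq_mean => -[x t] /=.
  rewrite (bigID (fun v : cube n => ~~ v i)) /=; congr (_ * _).
    by apply: eq_bigr => v vi; rewrite set_coord_id //; exact/negbTE.
  rewrite (reindex_onto (set_coord i true) (set_coord i false)) /=; last first.
    by move=> v; rewrite negbK => vi; rewrite set_coordK set_coord_id.
  rewrite rmorph_prod; apply: eq_big => [v|v].
    rewrite set_coord_at set_coordK /=.
    apply/eqP/idP => [<-|vi]; first by rewrite set_coord_at.
    by rewrite set_coord_id //; exact/negbTE.
  rewrite set_coord_at set_coordK /= => /eqP vE.
  have vi : ~~ v i by rewrite -vE set_coord_at.
  rewrite group_cube_set_coord // /twist weight_set_coord //=.
  by case: (odd _) => /=; rewrite ?conjcK.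
(* A dummy average over [s] is inserted, and t_i is translated by [s]; only the base point of the
   second face feels this. *)
transitivity (mean (fun x => mean (fun s => mean (fun t =>
    A false x t * (A true (x + t i + s) t)^*%C)))).
  apply: eq_mean => x; rewrite -[LHS](@mean_cst R Z); last first.
    by apply/card_gt0P; exists 0.
  apply: eq_mean => s.
  pose e : {ffun 'I_n -> Z} := [ffun j => if j == i then s else 0].
  rewrite -(mean_bij _ (h := fun t => t + e)) /=; last first.
    by exists (fun t => t - e) => t; rewrite ?addrK ?subrK.
  by apply: eq_mean => t /=; rewrite !A_shift !ffunE eqxx addrA.
(* For fixed [x] and [t], the point y = x + t_i + s is uniform when [s] is. *)
transitivity (mean (fun x => mean (fun t => mean (fun y =>
    A false x t * (A true y t)^*%C)))).
  apply: eq_mean => x; rewrite mean_exchange; apply: eq_mean => t.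
  rewrite -(mean_bij (fun y => A false x t * (A true y t)^*%C)
    (h := fun y => x + t i + y)) //.
rewrite mean_exchange; apply: eq_mean => t.
rewrite -mean_conj -meanMr; apply: eq_mean => x; exact: meanMl.
Qed.

Lemma slice_set_coord f i b c t :
  slice (fun v => f (set_coord i c v)) i b t = slice f i c t.
Proof.
by apply: eq_mean => x; apply: eq_bigr => v _; rewrite set_coordK.
Qed.

(** Both faces now carry the same functions, so the two slices coincide and their product is a
    squared modulus. *)
Lemma gowers_form_set_coord f i b :
  gowers_form (fun v => f (set_coord i b v)) =
  mean (fun t => `|slice f i b t| ^+ 2).
Proof.
rewrite (gowers_form_slice _ i); apply: eq_mean => t.
by rewrite !slice_set_coord -sqr_normc.
Qed.

Lemma gowers_form_set_coord_ge0 f i b :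
  0 <= gowers_form (fun v => f (set_coord i b v)).
Proof.
by rewrite gowers_form_set_coord mean_ge0 // => t; rewrite exprn_ge0.
Qed.

Lemma gowers_form_CauchySchwarz f i : `|gowers_form f| ^+ 2 <=
  gowers_form (fun v => f (set_coord i false v)) *
  gowers_form (fun v => f (set_coord i true v)).
Proof.
rewrite !gowers_form_set_coord (gowers_form_slice f i).
exact: mean_CauchySchwarz.
Qed.

Lemma norm_gowers_form f : `|gowers_form f| <=
  mean (fun p : Z * {ffun 'I_n -> Z} =>
    \prod_v `|f v (group_cube p.1 p.2 v)|).
Proof.
apply: (le_trans (norm_mean _)); apply: le_mean => p; rewrite normr_prod.
by rewrite (eq_bigr _ (fun v _ => norm_twist v _)).
Qed.

Lemma norm_gowers_form_le1 f :
  (forall v x, `|f v x| <= 1) -> `|gowers_form f| <= 1.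
Proof.
move=> f1; apply: (le_trans (norm_gowers_form f)).
rewrite -[leRHS](@mean_cst R (Z * {ffun 'I_n -> Z})%type); last first.
  by apply/card_gt0P; exists 0.
by apply: le_mean => p; apply: prodr_ile1 => v _; rewrite normr_ge0 f1.
Qed.

(** All factors but the one at [w] are discarded, and the vertex at [w] is uniform. This serves for
    an error term that is small only in mean. *)
Lemma norm_gowers_form_le_mean f w :
  (forall v x, v != w -> `|f v x| <= 1) ->
  `|gowers_form f| <= mean (fun x => `|f w x|).
Proof.
move=> f1; apply: (le_trans (norm_gowers_form f)).
rewrite -(mean_group_cube w); apply: le_mean => p.
rewrite (bigD1 w) //= ler_piMr //; apply: prodr_ile1 => v vw.
by rewrite normr_ge0 f1.
Qed.

Definition set_coords (s : seq 'I_n) w v : cube n :=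
  [ffun j => if j \in s then w j else v j].

(* Cauchy-Schwarz in the coordinates of s in turn, each time discarding the
   factor of the face that does not contain w. *)
Lemma gowers_form_set_coords f (s : seq 'I_n) w :
  (forall v x, `|f v x| <= 1) ->
  `|gowers_form f| ^+ (2 ^ size s) <=
  `|gowers_form (fun v => f (set_coords s w v))|.
Proof.
elim: s f => [|i s IH] f f1 /=.
  rewrite expn0 expr1 (eq_gowers_form (g := f)) // => v x.
  by congr f; apply/ffunP => j; rewrite ffunE.
rewrite expnSr exprM.
apply: le_trans (_ : `|gowers_form (fun v => f (set_coords s w v))| ^+ 2 <= _).
  by apply: lerXn2r; rewrite ?nnegrE ?exprn_ge0 // IH.
apply: (le_trans (gowers_form_CauchySchwarz _ i)).
(* Both forms lie between 0 and 1, so their product is at most either of them. *)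
have face b :
    0 <= gowers_form (fun v => f (set_coords s w (set_coord i b v))) <= 1.
  have ge0 := gowers_form_set_coord_ge0 (fun v => f (set_coords s w v)) i b.
  by rewrite ge0 -(ger0_norm ge0) norm_gowers_form_le1.
have -> : gowers_form (fun v => f (set_coords (i :: s) w v)) =
    gowers_form (fun v => f (set_coords s w (set_coord i (w i) v))).
  apply: eq_gowers_form => v x; congr f; apply/ffunP => j.
  by rewrite !ffunE inE; case: eqP => // ->; case: ifP.
have /andP[F0 F1] := face false; have /andP[T0 T1] := face true.
by case: (w i); rewrite ger0_norm // ?ler_piMl // ler_piMr.
Qed.

(** Once every coordinate has been treated, each vertex carries the function [f w]. *)
Lemma gowers_form_le_slot f w : (forall v x, `|f v x| <= 1) ->
  `|gowers_form f| ^+ (2 ^ n) <= `|gowers_form (fun _ : cube n => f w)|.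
Proof.
move=> /(gowers_form_set_coords (enum 'I_n) w); rewrite size_enum_ord.
rewrite [X in _ <= `|X|](eq_gowers_form (g := fun _ => f w)) // => v x.
by congr f; apply/ffunP => j; rewrite ffunE mem_enum.
Qed.

(** Additivity of the form in the slot [w], since conjugation is additive. The families are compared
    pointwise off [w], so that differently written hybrids can be matched. *)
Lemma gowers_formD f g h w :
  (forall v, v != w -> f v = h v /\ g v = h v) ->
  (forall x, h w x = f w x + g w x) ->
  gowers_form h = gowers_form f + gowers_form g.
Proof.
move=> fgh hw; rewrite !gowers_formE -meanD; apply: eq_mean => p.
rewrite (bigD1 w) //= hw [X in _ = X + _](bigD1 w) //=.
rewrite [X in _ = _ + X](bigD1 w) //=.
have eq_rest u : (forall v, v != w -> u v = h v) ->
    \prod_(v | v != w) twist v (u v (group_cube p.1 p.2 v)) =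
    \prod_(v | v != w) twist v (h v (group_cube p.1 p.2 v)).
  by move=> uh; apply: eq_bigr => v vw; rewrite uh.
rewrite (eq_rest f) => [|v /fgh[]//]; rewrite (eq_rest g) => [|v /fgh[]//].
by rewrite -mulrDl /twist; case: ifP; rewrite ?rmorphD.
Qed.

End GowersForm.

(** * Gowers norms and the cost of perturbing a bounded function *)

Section Uniformity.
Variables (R : realType) (Z : finZmodType).
Implicit Types f g u : Z -> R[i].

Lemma cabsE (z : R[i]) : (cabs z)%:C%C = `|z|.
Proof. by case: z => a b; rewrite normc_def. Qed.

Lemma cabs_ge0 (z : R[i]) : 0 <= cabs z.
Proof. by rewrite -ler0c cabsE. Qed.

Lemma norm1E f : (norm1 f)%:C%C = mean (fun x => `|f x|).
Proof.
rewrite /norm1 rmorphM fmorphV rmorph_nat rmorph_sum.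
by rewrite (eq_bigr _ (fun x _ => cabsE (f x))).
Qed.

Lemma bounded_by_norm f (b : R) :
  bounded_by f b -> forall x, `|f x| <= b%:C%C.
Proof. by move=> fb x; rewrite -cabsE lecR. Qed.

Lemma gowers_form_ge0 n u : 0 <= gowers_form (fun _ : cube n.+1 => u).
Proof. exact: (gowers_form_set_coord_ge0 (fun _ => u) ord0 false). Qed.

(** The form is a nonnegative real, so taking its real part loses nothing and the root can be
    undone. *)
Lemma gowers_normX n u :
  (gowers_norm n.+1 u)%:C%C ^+ (2 ^ n.+1) =
  gowers_form (fun _ : cube n.+1 => u).
Proof.
have F0 := gowers_form_ge0 n u; set F := gowers_form _ in F0 *.
have FE : F = (complex.Re F)%:C%C by rewrite RRe_real // ger0_real.
have ReF0 : 0 <= complex.Re F by rewrite -ler0c -FE.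
rewrite [RHS]FE -rmorphXn /gowers_norm -/F -powR_mulrn ?powR_ge0 //.
by rewrite -powRrM mulVf ?powRr1 // pnatr_eq0 expn_eq0.
Qed.

(* Replacing the functions f by g one vertex at a time changes the form by a
   term containing e in one slot and a term containing r in one slot. *)
Lemma gowers_form_perturbation n f g e r :
  (forall x, f x = g x + e x + r x) ->
  bounded_by f 1 -> bounded_by g 1 -> bounded_by r 1 ->
  `|gowers_form (fun _ : cube n.+1 => f)
    - gowers_form (fun _ : cube n.+1 => g)| <=
  ((2 ^ n.+1)%:R * (norm1 e + gowers_norm n.+1 r))%:C%C.
Proof.
move=> fE /bounded_by_norm f1 /bounded_by_norm g1 /bounded_by_norm r1.
(* The hybrids interpolate between the constant families [g] (empty [s]) and [f] ([s] listing all
   vertices). *)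
pose hybrid (s : seq (cube n.+1)) v := if v \in s then f else g.
pose upd h (w : cube n.+1) u v := if v == w then u else h v.
have hybrid1 s v x : `|hybrid s v x| <= 1 by rewrite /hybrid; case: ifP.
have slot_e s w : `|gowers_form (upd (hybrid s) w e)| <= (norm1 e)%:C%C.
  apply: (le_trans (norm_gowers_form_le_mean (w := w) _)) => [v x vw|].
    by rewrite /upd (negbTE vw).
  by rewrite /upd eqxx norm1E.
(* Here the Gowers-Cauchy-Schwarz inequality applies, after both sides are raised to the power
   2^(n+1). *)
have slot_r s w :
    `|gowers_form (upd (hybrid s) w r)| <= (gowers_norm n.+1 r)%:C%C.
  have N0 : 0 <= (gowers_norm n.+1 r)%:C%C by rewrite ler0c powR_ge0.
  rewrite -(ler_pXn2r (n := (2 ^ n.+1)%N)) ?nnegrE ?expn_gt0 // gowers_normX.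
  apply: (le_trans (gowers_form_le_slot w _)) => [v x|].
    by rewrite /upd; case: ifP.
  by rewrite /upd eqxx ger0_norm ?gowers_form_ge0.
(* Adding a new vertex [w] to [s] changes [g] into [g + e + r] in that slot alone. Uniqueness
   ensures that [w] still carried [g]. *)
have telescope s : uniq s ->
    `|gowers_form (hybrid s) - gowers_form (hybrid [::])| <=
    ((size s)%:R * (norm1 e + gowers_norm n.+1 r))%:C%C.
  elim: s => [|w s IH] /=; first by rewrite subrr normr0 mul0r.
  case/andP=> ws /IH{}IH.
  have -> : gowers_form (hybrid (w :: s)) = gowers_form (hybrid s) +
      (gowers_form (upd (hybrid s) w e) + gowers_form (upd (hybrid s) w r)).
    rewrite -(gowers_formD (w := w)
      (h := upd (hybrid s) w (fun x => e x + r x))).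
    - apply: gowers_formD (w) _ _ => [v /negbTE vw|x].
        by rewrite /upd /hybrid inE vw.
      by rewrite /upd /hybrid inE eqxx (negbTE ws) /= fE addrA.
    - by move=> v /negbTE vw; rewrite /upd vw.
    - by move=> x; rewrite /upd eqxx.
  rewrite addrAC -[(size s).+1]add1n natrD mulrDl mul1r addrC rmorphD.
  apply: (le_trans (ler_normD _ _)); apply: lerD => //.
  by apply: (le_trans (ler_normD _ _)); rewrite rmorphD lerD.
have := telescope _ (enum_uniq (cube n.+1)).
rewrite -cardE card_ffun card_bool card_ord.
rewrite (eq_gowers_form (g := fun _ => f)) => [//|v x].
by rewrite /hybrid mem_enum.
Qed.

(** * Inner products and correlation with the structured part *)

Lemma inner_self u : inner u u = mean (fun x => `|u x| ^+ 2).
Proof. by apply: eq_mean => x; rewrite sqr_normc. Qed.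

(** Two distinct vertices are kept, which exist because n > 0, and the other factors are at most 1.
    The product of the two is bounded by the mean of their squares, and each vertex is uniform. *)
Lemma gowers_form_le_inner n u : (0 < n)%N -> bounded_by u 1 ->
  `|gowers_form (fun _ : cube n => u)| <= inner u u.
Proof.
case: n => // n _ /bounded_by_norm u1; apply: (le_trans (norm_gowers_form _)).
have neq : cube1 n.+1 != cube0 n.+1.
  by apply/eqP => /ffunP/(_ ord0); rewrite !ffunE.
pose q (v : cube n.+1) (p : Z * {ffun 'I_n.+1 -> Z}) :=
  `|u (group_cube p.1 p.2 v)| ^+ 2.
apply: (@le_trans _ _ (mean (fun p => 2^-1 * (q (cube0 _) p + q (cube1 _) p)))).
  apply: le_mean => p.
  rewrite (bigD1 (cube0 _)) //= (bigD1 (cube1 _)) //= mulrA.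
  apply: le_trans (_ : `|u (group_cube p.1 p.2 (cube0 _))| *
    `|u (group_cube p.1 p.2 (cube1 _))| <= _).
    rewrite ler_piMr ?mulr_ge0 //; apply: prodr_ile1 => v _.
    by rewrite normr_ge0 u1.
  rewrite [leRHS]mulrC; apply: (real_leif_mean_square _ _).1; exact: normr_real.
rewrite meanMl meanD !(mean_group_cube _ (fun x => `|u x| ^+ 2)) -inner_self.
by rewrite -mulr2n -[inner u u *+ 2]mulr_natl mulKf // pnatr_eq0.
Qed.

Lemma innerDl f g h : inner (fun x => f x + g x) h = inner f h + inner g h.
Proof. by rewrite -meanD; apply: eq_mean => x; rewrite mulrDl. Qed.

Lemma innerDr f g h : inner f (fun x => g x + h x) = inner f g + inner f h.
Proof. by rewrite -meanD; apply: eq_mean => x; rewrite rmorphD mulrDr. Qed.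

Lemma inner_sumr (T : Type) (s : seq T) f (g : T -> Z -> R[i]) :
  inner f (fun x => \sum_(j <- s) g j x) = \sum_(j <- s) inner f (g j).
Proof.
by rewrite -mean_sum; apply: eq_mean => x; rewrite rmorph_sum mulr_sumr.
Qed.

Lemma norm_inner_le_norm1 f g :
  bounded_by g 1 -> `|inner f g| <= (norm1 f)%:C%C.
Proof.
move=> /bounded_by_norm g1; apply: (le_trans (norm_mean _)).
rewrite norm1E; apply: le_mean => x.
by rewrite normrM normcJ ler_piMr.
Qed.

Lemma norm_inner_le_sup f g (b : R) :
  bounded_by f 1 -> bounded_by g b -> `|inner f g| <= b%:C%C.
Proof.
move=> /bounded_by_norm f1 /bounded_by_norm gb; apply: (le_trans (norm_mean _)).
rewrite -[leRHS](@mean_cst R Z); last by apply/card_gt0P; exists 0.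
by apply: le_mean => x; rewrite normrM normcJ (le_trans _ (gb x)) // ler_piMl.
Qed.

Lemma gowers_norm_le_sum_inner (T : Type) (s : seq T) (n : nat)
    f fs fe fr ge (g : T -> Z -> R[i]) (eta eps : R) :
  (forall x, f x = fs x + fe x + fr x) ->
  (forall x, fs x = \sum_(j <- s) g j x + ge x) ->
  bounded_by f 1 -> bounded_by fs 1 -> bounded_by fr 1 ->
  norm1 fe <= eta -> gowers_norm n.+1 fr <= eps ->
  cabs (inner fr fs) <= eps -> bounded_by ge eta ->
  gowers_norm n.+1 f ^+ (2 ^ n.+1) <=
  ((2 ^ n.+1)%:R + 2) * (eta + eps) + \sum_(j <- s) cabs (inner f (g j)).
Proof.
move=> fE fsE f1 fs1 fr1 fe_eta fr_eps fr_fs ge_eta.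
have pert : `|gowers_form (fun _ : cube n.+1 => f)
      - gowers_form (fun _ : cube n.+1 => fs)| <=
    ((2 ^ n.+1)%:R * (eta + eps))%:C%C.
  apply: (le_trans (gowers_form_perturbation n fE f1 fs1 fr1)).
  by rewrite lecR ler_wpM2l ?lerD.
have fs_form := gowers_form_le_inner (ltn0Sn n) fs1.
(* One copy of [fs] is replaced by [f - fe - fr]; in the resulting term with [f], the other copy is
   expanded into the [g j] and [ge]. *)
have fs_fs : inner fs fs =
    \sum_(j <- s) inner f (g j) + inner f ge - inner fe fs - inner fr fs.
  have -> : \sum_(j <- s) inner f (g j) + inner f ge = inner f fs.
    by rewrite -inner_sumr -innerDr; apply: eq_mean => x; rewrite fsE.
  have -> : inner f fs = inner fs fs + inner fe fs + inner fr fs.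
    by rewrite -!innerDl; apply: eq_mean => x; rewrite fE.
  by ring.
have sum_le : `|\sum_(j <- s) inner f (g j)| <=
    (\sum_(j <- s) cabs (inner f (g j)))%:C%C.
  rewrite rmorph_sum (eq_bigr _ (fun j _ => cabsE (inner f (g j)))).
  exact: ler_norm_sum.
have ge_le := norm_inner_le_sup f1 ge_eta.
have fe_le : `|inner fe fs| <= eta%:C%C.
  by apply: (le_trans (norm_inner_le_norm1 _ fs1)); rewrite lecR.
have fr_le : `|inner fr fs| <= eps%:C%C by rewrite -cabsE lecR.
rewrite -lecR rmorphXn gowers_normX -[leLHS]ger0_norm ?gowers_form_ge0 //.
rewrite -[X in `|X|](subrK (gowers_form (fun _ : cube n.+1 => fs))).
have fs_le : inner fs fs <=
    (\sum_(j <- s) cabs (inner f (g j)))%:C%C + eta%:C%C + eta%:C%C + eps%:C%C.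
  rewrite -[leLHS]ger0_norm; last first.
    by rewrite inner_self mean_ge0 // => x; rewrite exprn_ge0.
  rewrite fs_fs; do 2 (apply: (le_trans (ler_normB _ _)); apply: lerD => //).
  by apply: (le_trans (ler_normD _ _)); apply: lerD.
apply: (le_trans (ler_normD _ _)).
apply: (le_trans (lerD pert (le_trans fs_form fs_le))).
(* The passage to [inner fs fs] costs 2^(n+1) (eta + eps), and its expansion costs 2 eta + eps;
   since eps >= 0 the latter is at most 2 (eta + eps). *)
have eps0 : 0 <= eps by apply: le_trans (cabs_ge0 _) fr_fs.
by rewrite -!rmorphD lecR; lra.
Qed.

End Uniformity.

(** * Choice of thresholds and the averaging argument over the characters *)

Theorem theorem5p3 (R : realType) (k : nat) (hk : (0 < k)%N)
    (delta : R) (hdelta : 0 < delta) :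
  exists eta0 eps0 : R, 0 < eta0 /\ 0 < eps0 /\
  forall (ch : fixed_choices R) (D : R -> nat -> R) (eta : R) (N : nat),
    (forall (e : R) (m : nat), 0 < e -> 0 < D e m) ->
    0 < eta -> regularity_number ch k D eta N ->
    eta <= eta0 -> (forall m : nat, D eta m <= eps0) ->
  exists c : R, 0 < c /\
  forall (Z : finZmodType) (f : Z -> R[i]) (m : nat)
    (rd : regularity_data ch k D eta m f),
    bounded_by f 1 -> (1 <= m <= N)%N -> delta <= gowers_norm k.+1 f ->
    (exists2 chi, chi \in rd_S rd &
       delta ^+ (2 ^ k.+1) / (4 * #|` rd_S rd|%:R)
         <= cabs (inner f (rd_g rd chi))) /\
    c <= delta ^+ (2 ^ k.+1) / (4 * #|` rd_S rd|%:R).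
Proof.
pose P := delta ^+ (2 ^ k.+1); pose L : R := (2 ^ k.+1)%:R + 2.
have P0 : 0 < P by rewrite exprn_gt0.
have L0 : 0 < L by rewrite ltr_wpDl.
have e00 : 0 < P / (4 * L) by rewrite divr_gt0 ?mulr_gt0.
(* With both thresholds equal to P / (4 L), the total error L (eta + D eta m) is at most P / 2. *)
exists (P / (4 * L)), (P / (4 * L)); do 2 split=> //.
move=> ch D eta N _ eta_gt0 _ eta_le D_le.
(* The sum dominates [Qmax ch eta m] for every m <= N at once, so [c] is fixed before [Z] and [f];
   the successor makes it positive. *)
pose Q := (\sum_(m < N.+1) Qmax ch eta m).+1.
exists (P / (4 * Q%:R)); split=> [|Z f m rd f1 /andP[_ mN] f_delta].
  by rewrite divr_gt0 ?mulr_gt0 ?ltr0Sn.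
have /and3P[] : [&& gowers_norm k.+1 (rd_fr rd) <= D eta m,
    cabs (inner (rd_fr rd) (rd_fs rd)) <= D eta m &
    cabs (inner (rd_fr rd) (rd_fe rd)) <= D eta m].
  by have := rd_fr_small rd; rewrite !ge_max.
move=> fr_norm fr_fs _.
have fs1 : bounded_by (rd_fs rd) 1 by move=> x; apply: rd_F_bounded.
have main := gowers_norm_le_sum_inner (rd_decomposition rd) (rd_fourier rd)
  f1 fs1 (rd_fr_bounded rd) (rd_fe_small rd) fr_norm fr_fs (rd_ge_small rd).
set T := \sum_(_ <- _) _ in main.
have {main} T_ge : P / 2 <= T.
  have P_le : P <= gowers_norm k.+1 f ^+ (2 ^ k.+1).
    by apply: lerXn2r; rewrite ?nnegrE ?powR_ge0 // ltW.
  have err : L * (eta + D eta m) <= P / 2.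
    have -> : P / 2 = L * (P / (4 * L) + P / (4 * L)) by field; rewrite gt_eqF.
    by rewrite ler_pM2l // lerD.
  by have := le_trans P_le main; rewrite -/L; lra.
(* An empty [S] would give T = 0, against T >= P / 2; from here on, division by its cardinality is
   genuine. *)
have S_gt0 : (0 < #|` rd_S rd|)%N.
  rewrite lt0n; apply/negP => /eqP/size0nil S0.
  by move: T_ge; rewrite /T S0 big_nil; lra.
have S0 : 0 < (#|` rd_S rd|)%:R :> R by rewrite ltr0n.
split; last first.
  rewrite -/P ler_pM2l // lef_pV2 ?posrE ?mulr_gt0 ?ltr0Sn //.
  rewrite ler_pM2l // ler_nat.
  apply: (leq_trans (rd_S_card rd)); rewrite /Q -ltnS in mN *.
  by rewrite ltnW // ltnS (bigD1 (Ordinal mN)) //= leq_addr.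
(* If every correlation were below P / (4 |S|), summing over [S] would give T <= P / 4, against T >=
   P / 2. *)
rewrite -/P; have [//|no] := pselect (exists2 chi, chi \in rd_S rd &
  P / (4 * #|` rd_S rd|%:R) <= cabs (inner f (rd_g rd chi))).
suff : T <= P / 4 by lra.
have -> : P / 4 = \sum_(chi <- rd_S rd) P / (4 * #|` rd_S rd|%:R).
  rewrite big_const_seq count_predT iter_addr_0 -mulr_natl.
  by field; rewrite gt_eqF.
rewrite /T big_seq [leRHS]big_seq; apply: ler_sum => chi chiS.
by rewrite leNgt; apply/negP => /ltW le; apply: no; exists chi.
Qed.
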